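(* Let $\alpha: Y \times G \to Y$, $(y,g) \mapsto yg$, be a (right) action of an affine algebraic group $G$ on an affine variety $Y$, let $y \in Y$, and let $D$ be a relative boundary hull of the orbit $yG$. Then there exist finitely many group elements $g_1, \ldots, g_\ell \in G$ such that $$ yG = \overline{yG} \setminus \left( D \cap D g_1 \cap \ldots \cap D g_\ell \right). $$ In particular, the orbit $yG$ is described by its closure together with a single relative boundary hull $D$ and finitely many translates of $D$, so that no further relative boundary hulls have to be computed.
   Context: Varieties carry the Zariski topology. The orbit is $yG = \{ yg \mid g \in G\}$, i.e. the image of the orbit morphism $\alpha_y: G \to Y$, $g \mapsto yg$, and $\overline{yG}$ is its Zariski closure in $Y$. For $D \subseteq Y$ and $g \in G$, $Dg = \{ dg \mid d \in D\}$. Relative boundary hull: for a nonempty subset $A$ of a topological space, a closed set $D$ is called a relative boundary hull of $A$ if $\overline{A} \setminus A \subseteq D \subsetneq \overline{A}$. *)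

(* Defs.v *)
From HB Require Import structures.
From mathcomp Require Import all_boot all_order all_algebra.
From mathcomp Require Import all_classical.
From mathcomp Require Import topology.
(* Without notations: those of mpoly clash with MathComp-Analysis. *)
From mathcomp Require Import -(notations) mpoly.

Set Implicit Arguments.
Unset Strict Implicit.
Unset Printing Implicit Defensive.

Import GRing.Theory.

Local Open Scope classical_set_scope.
Local Open Scope ring_scope.

Definition relative_boundary_hull (T : topologicalType) (A D : set T) : Prop :=
  [/\ A !=set0, closed D, closure A `\` A `<=` D & D `<` closure A].

Definition affine_space (k : Type) (n : nat) : Type := 'rV[k]_n.

HB.instance Definition _ (k : choiceType) (n : nat) :=
  Choice.copy (affine_space k n) 'rV[k]_n.

Definition coord (k : Type) (n : nat) (x : affine_space k n) (i : 'I_n) : k :=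
  (x : 'rV[k]_n) ord0 i.

Definition zero_locus (k : fieldType) (n : nat) (S : set (mpoly n k)) :
  set (affine_space k n) :=
  [set x | forall p, S p -> meval (coord x) p = 0].

Definition zariski_open (k : fieldType) (n : nat) : set_system (affine_space k n) :=
  [set U | exists S : set (mpoly n k), ~` U = zero_locus S].

Section ZariskiTopology.
Variables (k : fieldType) (n : nat).

Lemma zariski_openT : zariski_open (@setT (affine_space k n)).
Proof.
exists [set (1 : mpoly n k)]; rewrite setCT; apply/seteqP; split => // x /(_ 1 erefl) /eqP.
by rewrite meval1 oner_eq0.
Qed.

Lemma zariski_openI : setI_closed (@zariski_open k n).
Proof.
move=> U V [S hS] [T hT].
exists [set r | exists p q, [/\ S p, T q & r = p * q]].
rewrite setCI hS hT; apply/seteqP; split => [x [Sx|Tx] _ [p [q [Sp Tq ->]]]|x STx].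
- by rewrite mevalM (Sx _ Sp) mul0r.
- by rewrite mevalM (Tx _ Tq) mulr0.
have [Sx|/existsNP[p /not_implyP[Sp px]]] := pselect (zero_locus S x).
  by left.
right=> q Tq; have /eqP := STx (p * q) (ex_intro _ p (ex_intro _ q (And3 Sp Tq erefl))).
by rewrite mevalM mulf_eq0 => /orP[/eqP //|/eqP].
Qed.

Lemma zariski_open_bigU (I : Type) (f : I -> set (affine_space k n)) :
  (forall i, zariski_open (f i)) -> zariski_open (\bigcup_i f i).
Proof.
move=> of_; exists [set p | exists2 S, S p & exists i, ~` f i = zero_locus S].
rewrite setC_bigcup; apply/seteqP; split => [x fx p [S Sp [i fiS]]|x Sx i _].
  by have := fx i Logic.I; rewrite fiS; apply.
have [S fiS] := of_ i; rewrite fiS => p Sp; apply: Sx.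
by exists S => //; exists i.
Qed.

HB.instance Definition _ := isOpenTopological.Build (affine_space k n)
  zariski_openT zariski_openI zariski_open_bigU.

Lemma zariski_closedP (A : set (affine_space k n)) :
  closed A <-> exists S : set (mpoly n k), A = zero_locus S.
Proof.
rewrite -openC -[open _]/(zariski_open _) /zariski_open /= setCK.
by split.
Qed.

End ZariskiTopology.

Definition polynomial_map (k : fieldType) (n m : nat)
    (p : 'I_m -> mpoly n k) (x : affine_space k n) : affine_space k m :=
  (\row_j meval (coord x) (p j) : 'rV[k]_m).

Lemma closed_preimage_polynomial_map (k : fieldType) (n m : nat)
    (p : 'I_m -> mpoly n k) (A : set (affine_space k m)) :
  closed A -> closed (polynomial_map p @^-1` A).
Proof.
move=> /zariski_closedP[S ->]; apply/zariski_closedP.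
exists [set q | exists2 r, S r & q = comp_mpoly [tuple p j | j < m] r].
have mevalE x r : meval (coord x) (comp_mpoly [tuple p j | j < m] r)
    = meval (coord (polynomial_map p x)) r.
  rewrite comp_mpoly_meval; apply: meval_eq => j.
  by rewrite tnth_mktuple /coord /polynomial_map mxE.
apply/seteqP; split => [x Sx _ [r Sr ->]|x Sx r Sr].
  by rewrite mevalE Sx.
by rewrite -mevalE; apply: Sx; exists r.
Qed.

(* Affine varieties over an arbitrary field k are identified with their sets of
   k-points: closed subsets of affine space, not necessarily irreducible, so that algebraic groups need not be connected.  The points of a
   variety X form the type [set_type X], which carries the subspace topology. *)
Record affine_variety (k : fieldType) := AffineVariety {
  av_dim : nat;
  av_set :> set (affine_space k av_dim);
  av_closed : closed av_set }.

Arguments av_set {k} a _.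

Definition is_morphism (k : fieldType) (X Y : affine_variety k) (f : X -> Y) :
    Prop :=
  exists p : 'I_(av_dim Y) -> mpoly (av_dim X) k,
    forall x : X, val (f x) = polynomial_map p (val x).

Section Product.
Variables (k : fieldType) (X Y : affine_variety k).

Definition product_set : set (affine_space k (av_dim X + av_dim Y)) :=
  [set z | av_set X (lsubmx (z : 'rV[k]_(av_dim X + av_dim Y))) /\
           av_set Y (rsubmx (z : 'rV[k]_(av_dim X + av_dim Y)))].

Lemma product_closed : closed product_set.
Proof.
pose pl (i : 'I_(av_dim X)) : mpoly (av_dim X + av_dim Y) k :=
  mpolyX k (mnm1 (lshift (av_dim Y) i)).
pose pr (j : 'I_(av_dim Y)) : mpoly (av_dim X + av_dim Y) k :=
  mpolyX k (mnm1 (rshift (av_dim X) j)).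
rewrite (_ : product_set = polynomial_map pl @^-1` av_set X `&`
                           polynomial_map pr @^-1` av_set Y).
  by apply: closedI; apply: closed_preimage_polynomial_map; apply: av_closed.
have plE z : polynomial_map pl z = lsubmx (z : 'rV[k]_(av_dim X + av_dim Y)).
  by apply/rowP => i; rewrite !mxE mevalXU.
have prE z : polynomial_map pr z = rsubmx (z : 'rV[k]_(av_dim X + av_dim Y)).
  by apply/rowP => i; rewrite !mxE mevalXU.
by apply/seteqP; split => z /=; rewrite plE prE.
Qed.

Definition product_variety : affine_variety k := AffineVariety product_closed.

Definition product_fst (z : product_variety) : X :=
  SigSub (mem_set (proj1 (set_valP z))).

Definition product_snd (z : product_variety) : Y :=
  SigSub (mem_set (proj2 (set_valP z))).

End Product.

Definition is_morphism2 (k : fieldType) (X Y Z : affine_variety k)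
    (f : X -> Y -> Z) : Prop :=
  is_morphism (fun z : product_variety X Y => f (product_fst z) (product_snd z)).

Record affine_algebraic_group (k : fieldType) := AffineAlgebraicGroup {
  ag_variety :> affine_variety k;
  ag_one : ag_variety;
  ag_inv : ag_variety -> ag_variety;
  ag_mul : ag_variety -> ag_variety -> ag_variety;
  ag_mulA : associative ag_mul;
  ag_mul1 : left_id ag_one ag_mul;
  ag_mulV : left_inverse ag_one ag_inv ag_mul;
  ag_inv_morphism : is_morphism ag_inv;
  ag_mul_morphism : is_morphism2 ag_mul }.

Record right_action (k : fieldType) (Y : affine_variety k)
    (G : affine_algebraic_group k) := RightAction {
  act :> Y -> G -> Y;
  act_morphism : is_morphism2 act;
  act1 : forall y, act y (ag_one G) = y;
  actM : forall y g h, act y (ag_mul g h) = act (act y g) h }.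

Definition action_orbit (k : fieldType) (Y : affine_variety k)
    (G : affine_algebraic_group k) (alpha : right_action Y G) (y : Y) : set Y :=
  range (alpha y).

Definition action_translate (k : fieldType) (Y : affine_variety k)
    (G : affine_algebraic_group k) (alpha : right_action Y G) (D : set Y) (g : G) :
    set Y :=
  [set alpha d g | d in D].

(* Main.v *)
(** The translates of a single polynomial under the action span a
    finite-dimensional space: if [f] vanishes on [D] but not on the whole orbit,
    then [f (x h) = \sum_i v_i(h) u_i(x)] with finitely many terms. Choosing
    [h_1, ..., h_l] so that the vectors [v (h_i)] span all [v h], a point [x] with
    [f (x h_i) = 0] for every [i] satisfies [f (x h) = 0] for all [h] in [G], so it is
    not in the orbit. With [g_i = h_i^-1] this applies to every [x] in all the
    [D g_i]. Conversely the boundary of the orbit is [G]-stable and contained in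
    [D], hence it lies in every translate of [D]. In particular Hilbert's basis
    theorem is not needed. *)
Require Import Defs.
From mathcomp Require Import all_boot all_order all_algebra.
From mathcomp Require Import all_classical.
From mathcomp Require Import topology.
From mathcomp Require Import -(notations) mpoly.

(* Again, so that [coord] is not the one of vector.v. *)
Import Defs.
Import GRing.Theory.

Local Open Scope ring_scope.
Local Open Scope classical_set_scope.

(** Take [s] whose image spans a subspace of maximal dimension: adding any [t] cannot enlarge the
    span, so it contains every [v t], and it lies in the kernel of multiplication by [u]. *)
Lemma finite_annihilator (k : fieldType) (T : eqType) (n : nat) (v : T -> 'rV[k]_n) :
  exists s : seq T, forall u : 'cV[k]_n,
    {in s, forall t, v t *m u = 0} -> forall t, v t *m u = 0.
Proof.
pose P d := `[< exists s, \dim <<map v s>>%VS = d >].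
have exP : exists d, P d by exists (\dim <<map v [::]>>%VS); apply/asboolP; exists [::].
have leP d : P d -> (d <= \dim (fullv : {vspace 'rV[k]_n}))%N.
  by move=> /asboolP[s <-]; rewrite dimvS ?subvf.
have [d /asboolP[s sd] maxd] := ex_maxnP exP leP.
exists s => u us t.
have : v t \in <<map v s>>%VS.
  have sub : (<<map v s>> <= <<map v (t :: s)>>)%VS.
    by rewrite /= span_cons addvSr.
  have /eqP -> : <<map v s>>%VS == <<map v (t :: s)>>%VS.
    by rewrite eqEdim sub sd maxd //; apply/asboolP; exists (t :: s).
  by rewrite memv_span //= mem_head.
have /subvP sub : (<<map v s>> <= lker (linfun (mulmxr u)))%VS.
  by apply/span_subvP => _ /mapP[t' t's ->]; rewrite memv_ker lfunE /= us.
by move=> /sub; rewrite memv_ker lfunE => /eqP.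
Qed.

(** Each monomial of [p] factors into a part in [x] and a part in [h]; the coefficients go into
    [v]. *)
Lemma meval_row_mx (k : fieldType) (n m : nat) (p : mpoly (n + m) k) :
  exists (N : nat) (u : 'rV[k]_n -> 'cV[k]_N) (v : 'rV[k]_m -> 'rV[k]_N),
    forall x h, meval (coord (row_mx x h)) p = ((v h *m u x) ord0 ord0).
Proof.
pose e := in_tuple (msupp p).
exists (size (msupp p)),
  (fun x => \col_i (\prod_j x ord0 j ^+ tnth e i (lshift m j))),
  (fun h => \row_i (mcoeff (tnth e i) p * \prod_j h ord0 j ^+ tnth e i (rshift n j))).
move=> x h; rewrite mevalE big_tnth mxE; apply: eq_bigr => i _.
rewrite !mxE big_split_ord /= -mulrA; congr (_ * _); rewrite mulrC.
by congr (_ * _); apply: eq_bigr => j _; rewrite /coord ?row_mxEl ?row_mxEr.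
Qed.

Section Variety.
Variable k : fieldType.
Implicit Types X Y Z : affine_variety k.

Lemma variety_closedP X (A : set X) :
  closed A <-> exists2 B : set (affine_space k (av_dim X)), closed B & A = val @^-1` B.
Proof.
rewrite -openC; split=> [[B oB BA]|[B cB ->]].
  exists (~` B); first by rewrite closedC.
  by rewrite -[A]setCK -BA.
by exists (~` B); [rewrite openC|rewrite preimage_setC].
Qed.

Lemma closed_separation X (A : set X) (x : X) : closed A -> ~ A x ->
  exists p : mpoly (av_dim X) k,
    (forall a, A a -> meval (coord (val a)) p = 0) /\ meval (coord (val x)) p <> 0.
Proof.
move=> /variety_closedP[B /zariski_closedP[S ->] ->] /existsNP[p /not_implyP[Sp px]].
by exists p; split=> // a; apply.
Qed.

Lemma row_mx_product_set X Y (x : X) (y : Y) :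
  row_mx (val x : 'rV[k]_(av_dim X)) (val y : 'rV[k]_(av_dim Y)) \in @product_set k X Y.
Proof.
by apply/mem_set; rewrite /product_set /= row_mxKl row_mxKr; split; apply: set_valP.
Qed.

Lemma is_morphism2P X Y Z (f : X -> Y -> Z) : is_morphism2 f ->
  exists p : 'I_(av_dim Z) -> mpoly (av_dim X + av_dim Y) k, forall x y,
    val (f x y) = polynomial_map p (row_mx (val x : 'rV[k]__) (val y : 'rV[k]__)).
Proof.
move=> [p pE]; exists p => x y.
pose z : product_variety X Y := SigSub (row_mx_product_set _ _ x y).
have zx : product_fst z = x by apply: val_inj; rewrite /= row_mxKl.
have zy : product_snd z = y by apply: val_inj; rewrite /= row_mxKr.
by have := pE z; rewrite zx zy.
Qed.

Lemma closed_preimage_morphism2l X Y Z (f : X -> Y -> Z) (y : Y) (A : set Z) :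
  is_morphism2 f -> closed A -> closed ((fun x => f x y) @^-1` A).
Proof.
move=> /is_morphism2P[p pE] /variety_closedP[B cB ->]; apply/variety_closedP.
(* [q] describes the embedding of [x] as the pair [(x, y)]: variables in the first block, the
   constant coordinates of [y] in the second. *)
pose q (i : 'I_(av_dim X + av_dim Y)) : mpoly (av_dim X) k :=
  match fintype.split i with
  | inl j => mpolyX k (mnm1 j)
  | inr j => mpolyC _ (coord (val y) j)
  end.
exists (polynomial_map q @^-1` (polynomial_map p @^-1` B)).
  by do 2!apply: closed_preimage_polynomial_map.
have qE x : polynomial_map q x = row_mx (x : 'rV[k]__) (val y : 'rV[k]__).
  apply/rowP => i; rewrite /polynomial_map !mxE /q.
  by case: fintype.split => j; rewrite ?mevalXU ?mevalC.
by apply/seteqP; split => x /=; rewrite pE qE.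
Qed.

End Variety.

Section Action.
Variables (k : fieldType) (Y : affine_variety k) (G : affine_algebraic_group k).
Variable alpha : right_action Y G.
Implicit Types (x y : Y) (g h : G).

(** Derived from the left axioms by inserting the product of the inverse of [ag_inv g] with
    [ag_inv g]. *)
Lemma ag_mulgV g : ag_mul g (ag_inv g) = ag_one G.
Proof.
rewrite -[LHS]ag_mul1 -{1}(ag_mulV (ag_inv g)) -ag_mulA.
by rewrite (ag_mulA (ag_inv g)) ag_mulV ag_mul1 ag_mulV.
Qed.

Lemma actK g x : alpha (alpha x g) (ag_inv g) = x.
Proof. by rewrite -actM ag_mulgV act1. Qed.

Lemma actKV g x : alpha (alpha x (ag_inv g)) g = x.
Proof. by rewrite -actM ag_mulV act1. Qed.

Lemma action_orbitM y x g : action_orbit alpha y x -> action_orbit alpha y (alpha x g).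
Proof. by move=> [h _ <-]; exists (ag_mul h g); rewrite ?actM. Qed.

(** Acting by [g] is continuous, so the preimage of the closure is closed, and it contains the
    orbit. *)
Lemma closure_action_orbitM y x g :
  closure (action_orbit alpha y) x -> closure (action_orbit alpha y) (alpha x g).
Proof.
move=> cx; pose A := (fun x => alpha x g) @^-1` closure (action_orbit alpha y).
have cA : closed A.
  apply: closed_preimage_morphism2l; last exact: closed_closure.
  exact: act_morphism.
suff : closure (action_orbit alpha y) `<=` A by apply.
rewrite (closure_id A).1 //; apply: closure_subset => z oz.
exact/subset_closure/action_orbitM.
Qed.

Lemma boundary_translate y (D : set Y) g :
  closure (action_orbit alpha y) `\` action_orbit alpha y `<=` D ->
  closure (action_orbit alpha y) `\` action_orbit alpha y
    `<=` action_translate alpha D g.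
Proof.
move=> bD x [cx nox]; exists (alpha x (ag_inv g)); last exact: actKV.
apply: bD; split; first exact: closure_action_orbitM.
by move=> /(action_orbitM _ _ g); rewrite actKV.
Qed.

Lemma finite_zero_translates (p : mpoly (av_dim Y) k) :
  exists s : seq G, forall x,
    {in s, forall h, meval (coord (val (alpha x h))) p = 0} ->
    forall h, meval (coord (val (alpha x h))) p = 0.
Proof.
have [P PE] := is_morphism2P _ _ _ _ _ (act_morphism alpha).
pose q := comp_mpoly [tuple P j | j < av_dim Y] p.
have [N [u [v uvE]]] := meval_row_mx _ _ _ q.
have E x h : meval (coord (val (alpha x h))) p = ((v (val h) *m u (val x)) ord0 ord0).
  rewrite -uvE comp_mpoly_meval PE; apply: meval_eq => j.
  by rewrite tnth_mktuple /coord /polynomial_map mxE.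
have [s sP] := finite_annihilator _ _ _ (fun h : G => v (val h)).
exists s => x xs h; rewrite E sP ?mxE // => h' /xs.
by rewrite E => e; apply/matrixP => i j; rewrite !ord1 e mxE.
Qed.

End Action.

Theorem corollary7p3 (k : fieldType) (Y : affine_variety k)
    (G : affine_algebraic_group k) (alpha : right_action Y G) (y : Y) (D : set Y)
    (hD : relative_boundary_hull (action_orbit alpha y) D) :
  exists (l : nat) (g : 'I_l -> G),
    action_orbit alpha y =
    closure (action_orbit alpha y) `\`
      (D `&` \bigcap_(i in [set: 'I_l]) action_translate alpha D (g i)).
Proof.
have [_ cD bD [_ nDO]] := hD.
(* If the closed set [D] contained the orbit, it would contain the closure, against properness. *)
have /existsNP[_ /not_implyP[[g0 _ <-] nDy]] : ~ (action_orbit alpha y `<=` D).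
  by move=> OD; apply: nDO; rewrite [X in _ `<=` X](closure_id D).1 //; exact: closure_subset.
have [f [fD fy]] := closed_separation _ _ _ _ cD nDy.
have [s sP] := finite_zero_translates _ _ _ alpha f.
(* Inverses, because [x] in the translate of [D] by [ag_inv h] means that [alpha x h] lies in
   [D]. *)
exists (size s), (fun i => ag_inv (tnth (in_tuple s) i)).
apply/seteqP; split=> [x Ox|x [cx nDx]].
  split=> [|[_ Dx]]; first exact: subset_closure.
  have fx0 : forall h, meval (coord (val (alpha x h))) f = 0.
    apply: sP => h /(tnthP (in_tuple s))[i ->].
    by have [d Dd <-] := Dx i Logic.I; rewrite actKV; exact: fD.
  (* From [alpha y g], the element [ag_mul (ag_inv g) g0] leads to [alpha y g0], where [f] does not
     vanish. *)
  case: Ox fx0 => g _ <- fx0; apply: fy.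
  by rewrite -(fx0 (ag_mul (ag_inv g) g0)) actM actK.
apply: contrapT => nOx; apply: nDx; split; first exact: bD.
by move=> i _; exact: (boundary_translate _ _ _ _ _ _ _ bD).
Qed.
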